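(* Let $q=2^e$ with $e\ge3$ odd, let $r\ge2$, $\sigma=2^{\frac{e+1}{2}}$, and let $\varepsilon\in\mathbb{F}_{q^2}\setminus\mathbb{F}_q$ satisfy $\varepsilon^2+\varepsilon+\delta=0$ with $\delta\in\mathbb{F}_q\setminus\{1\}$, $\mathrm{Tr}_{q/2}(\delta)=1$. Then any Sylow $2$-subgroup of $\mathrm{Aut}(\mathcal{H}^r_\varepsilon)$ fixes a unique incident point-hyperplane pair of $\mathrm{PG}(r,q^2)$.
   Context: Points of $\mathrm{PG}(r,q^2)$ have homogeneous coordinates $(X_0,\ldots,X_r)$, and affine coordinates $x_i=X_i/X_0$ when $X_0\ne0$. In exponents, $\sigma$ denotes the integer $2^{(e+1)/2}$. $\mathrm{Tr}_{q/2}$ is the absolute trace of $\mathbb{F}_q$. Put $\Gamma_\varepsilon(x)=[x+(x^q+x)\varepsilon]^{\sigma+2}+(x^q+x)^\sigma+(x^{2q}+x^2)\varepsilon+x^{q+1}+x^2$. The BT quasi-Hermitian variety $\mathcal{H}^r_\varepsilon\subset\mathrm{PG}(r,q^2)$ is the set consisting of the affine points $(x_1,\ldots,x_r)\in\mathbb{F}_{q^2}^r$ with $x_r^q+x_r=\Gamma_\varepsilon(x_1)+\cdots+\Gamma_\varepsilon(x_{r-1})$, together with the points $(0,X_1,\ldots,X_r)$ with $X_1^{q+1}+\cdots+X_{r-1}^{q+1}=0$. $\mathrm{Aut}(\mathcal{H}^r_\varepsilon)$ is the full automorphism (collineation) group of $\mathcal{H}^r_\varepsilon$, i.e. its setwise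 stabilizer in $\mathrm{P\Gamma L}_{r+1}(q^2)$. An incident point-hyperplane pair is a pair $(P,\Pi)$ with $P\in\Pi$; a group fixes it if it fixes both $P$ and $\Pi$. *)

(* Defs.v *)
From HB Require Import structures.
From mathcomp Require Import all_boot all_order all_algebra all_fingroup.
From mathcomp Require Import all_solvable.

Set Implicit Arguments.
Unset Strict Implicit.
Unset Printing Implicit Defensive.

Import GroupScope GRing.Theory.
Local Open Scope ring_scope.

Section ProjectiveSpace.

Variable F : finFieldType.

(* A {vspace vT} is a matrix over F in reduced form, so there are finitely    *)
(* many of them when F is finite; {perm point} below relies on this.          *)
HB.instance Definition _ (vT : vectType F) : isCountable {vspace vT} :=
  CanIsCountable (@VectorInternalTheory.vs2mxK F vT).
HB.instance Definition _ (vT : vectType F) : isFinite {vspace vT} :=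
  CanIsFinite (@VectorInternalTheory.vs2mxK F vT).

Variable r : nat.

Definition point := {P : {vspace 'rV[F]_r.+1} | \dim P == 1%N}.

Definition hyperplane := {W : {vspace 'rV[F]_r.+1} | \dim W == r}.

Implicit Types (P : point) (W : hyperplane) (v : 'rV[F]_r.+1).

Definition incident P W : bool := (val P <= val W)%VS.

Definition points_of W : {set point} := [set P | incident P W].

Definition homogeneous_coords v P : bool := (v != 0) && (v \in val P).

Definition field_aut (theta : {perm F}) : bool :=
  [forall a, forall b, (theta (a + b) == theta a + theta b)
                    && (theta (a * b) == theta a * theta b)].

(* s is the permutation of the points of PG(r, F) induced by the semilinear   *)
(* bijection v |-> v^theta A.                                                 *)
Definition induced_by (theta : {perm F}) (A : 'M[F]_r.+1) (s : {perm point}) :=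
  [forall P : point, forall v : 'rV[F]_r.+1,
     (v \in val P) ==> (map_mx theta v *m A \in val (s P))].

(* Two semilinear bijections that differ by a scalar induce the same          *)
(* permutation, so this is the quotient of GammaL_(r+1)(F) by the scalars, in *)
(* its (faithful, when 0 < r) action on points.                               *)
Definition PGammaL : {set {perm point}} :=
  [set s | [exists theta : {perm F}, exists A : 'M[F]_r.+1,
              [&& field_aut theta, A \in unitmx & induced_by theta A s]]].

Lemma field_aut_morph theta : field_aut theta ->
  {morph theta : a b / a + b} /\ {morph theta : a b / a * b}.
Proof.
by move/forallP=> h; split=> a b; have /andP[/eqP ? /eqP ?] := forallP (h a) b.
Qed.

Lemma map_mx_field_autM theta m n p (A : 'M[F]_(m, n)) (B : 'M[F]_(n, p)) :
  field_aut theta -> map_mx theta (A *m B) = map_mx theta A *m map_mx theta B.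
Proof.
move=> /field_aut_morph[hD hM].
have h0 : theta 0 = 0 by apply: (addrI (theta 0)); rewrite -hD !addr0.
apply/matrixP=> i j; rewrite !mxE (big_morph theta hD h0).
by apply: eq_bigr => k _; rewrite hM !mxE.
Qed.

Lemma field_aut1 theta : field_aut theta -> theta 0 = 0 /\ theta 1 = 1.
Proof.
move=> /field_aut_morph[hD hM].
have h0 : theta 0 = 0 by apply: (addrI (theta 0)); rewrite -hD !addr0.
split=> //; have n0 : theta 1 != 0.
  by rewrite -[X in _ != X]h0 (inj_eq perm_inj) oner_neq0.
by apply: (mulfI n0); rewrite -hM !mulr1.
Qed.

Lemma PGammaL_group_set : group_set PGammaL.
Proof.
apply/group_setP; split=> [|s t].
  rewrite inE; apply/existsP; exists 1%g; apply/existsP; exists 1%:M.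
  rewrite unitmx1; apply/and3P; split=> //.
    by apply/forallP=> a; apply/forallP=> b; rewrite !perm1 !eqxx.
  apply/forallP=> P; apply/forallP=> v; apply/implyP=> vP.
  rewrite perm1 mulmx1; suff -> : map_mx (1%g : {perm F}) v = v by [].
  by apply/matrixP=> i j; rewrite mxE perm1.
rewrite !inE => /existsP[f /existsP[A /and3P[hf uA hA]]].
move=> /existsP[g /existsP[B /and3P[hg uB hB]]].
apply/existsP; exists (f * g)%g; apply/existsP; exists (map_mx g A *m B).
apply/and3P; split.
- have [fD fM] := field_aut_morph hf; have [gD gM] := field_aut_morph hg.
  apply/forallP=> a; apply/forallP=> b.
  by rewrite !permM fD fM gD gM !eqxx.
- rewrite unitmx_mul uB andbT.
  have [g0 g1] := field_aut1 hg.
  suff h : map_mx g A *m map_mx g (invmx A) = 1%:M by case: (mulmx1_unit h).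
  rewrite -map_mx_field_autM // mulmxV //.
  by apply/matrixP=> i j; rewrite !mxE; case: (i == j); rewrite ?g0 ?g1.
apply/forallP=> P; apply/forallP=> v; apply/implyP=> vP.
have h1 := implyP (forallP (forallP hA P) v) vP.
have := implyP (forallP (forallP hB (s P)) _) h1.
rewrite map_mx_field_autM // permM mulmxA.
suff -> : map_mx (f * g)%g v = map_mx g (map_mx f v) by [].
by apply/matrixP=> i j; rewrite !mxE permM.
Qed.

Canonical PGammaL_group := Group PGammaL_group_set.

End ProjectiveSpace.

Section BTQuasiHermitian.

Variables (F : finFieldType) (e : nat).

Local Notation q := (2 ^ e)%N.
Local Notation sigma := (2 ^ (e.+1)./2)%N.

(* The unique subfield of order q of F, when F has order q ^ 2.               *)
Definition subfield_q : {set F} := [set x | x ^+ q == x].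

(* The absolute trace of the subfield of order q, with values in F.           *)
Definition abs_trace (x : F) : F := \sum_(i < e) x ^+ (2 ^ i).

Definition Gamma (eps x : F) : F :=
  (x + (x ^+ q + x) * eps) ^+ (sigma + 2) + (x ^+ q + x) ^+ sigma
  + (x ^+ (2 * q) + x ^+ 2) * eps + x ^+ (q + 1) + x ^+ 2.

Variable r : nat.

Definition affine_coord (v : 'rV[F]_r.+1) (i : 'I_r.+1) : F := v 0 i / v 0 0.

Definition BT_affine (eps : F) (v : 'rV[F]_r.+1) : bool :=
  let x := affine_coord v in
  (v 0 0 != 0)
  && (x ord_max ^+ q + x ord_max
      == \sum_(i < r.+1 | (0 < i < r)%N) Gamma eps (x i)).

Definition BT_infinity (v : 'rV[F]_r.+1) : bool :=
  (v 0 0 == 0) && (\sum_(i < r.+1 | (0 < i < r)%N) v 0 i ^+ (q + 1) == 0).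

Definition BT_variety (eps : F) : {set point F r} :=
  [set P | [exists v, homogeneous_coords v P
                      && (BT_affine eps v || BT_infinity v)]].

Definition Aut_BT (eps : F) : {set {perm point F r}} :=
  'N_(PGammaL F r)(BT_variety eps | 'P).

Canonical Aut_BT_group (eps : F) := [group of Aut_BT eps].

End BTQuasiHermitian.

Definition fixes_flag (F : finFieldType) (r : nat) (S : {set {perm point F r}})
    (PW : point F r * hyperplane F r) : Prop :=
  [/\ incident PW.1 PW.2, S \subset 'C[PW.1 | 'P]
    & S \subset 'N(points_of PW.2 | 'P)].

(* Main.v *)
Require Import Defs.
From mathcomp Require Import all_boot all_order all_algebra all_fingroup.
From mathcomp Require Import all_solvable all_field ring.
Import GroupScope GRing.Theory.

(** Because [delta] lies in the subfield of order [q = 2 ^ e] and [eps] does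
    not, the two roots of [X^2 + X + delta] are exchanged by [x |-> x^q], so
    [eps^q = eps + 1] ([eps_conj]).  Writing [x = x0 + x1 eps] with [x0], [x1]
    in the subfield, one finds that [Gamma eps x] is the function
    [x0^(sigma+2) + x0 x1 + x1^sigma] of the Suzuki-Tits ovoid.  A translation
    in the [x1] direction, [x |-> x + b eps] with [b^q = b], changes it by
    [b x0 + b^sigma].  The part [b x0] is the trace of [b eps^q x], which is
    linear in [x], so that a shear of the last coordinate absorbs it
    ([Gamma_shift]).  Consequently the maps
      [x_i |-> x_i + b_i eps] for [0 < i < r],
      [x_r |-> x_r + sum_i b_i eps^q x_i + c],
    with [b_i^q = b_i] and [c^q + c = sum_i b_i^sigma], preserve the variety.
    They form a group of exponent dividing 4 ([heis_group_2group],
    [heis_group_Aut]).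

    Any point fixed by this 2-group is [(0, ..., 0, 1)] and any hyperplane fixed
    by it is [X_0 = 0] ([heis_fix_point], [heis_fix_hyperplane]): the elation
    with [b = 0], [c = 1] and the maps with a single [b_i = 1] suffice to see
    this.

    By Sylow's theorem some conjugate [T] of this group lies in the given Sylow
    subgroup [S].  When [T] fixes exactly one element [x] of a set on which [S]
    acts, so does [S]: the orbit of [x] under [S] has 2-power size, and modulo 2
    this size is the number of points of the orbit fixed by [T], which is 1
    ([afix_unique_pgroup]).  This is used twice, for points and for hyperplanes.
    Hyperplanes are handled as sets of points, which collineations permute
    ([PGammaL_hyperplane]). *)

Set Implicit Arguments.
Unset Strict Implicit.
Unset Printing Implicit Defensive.
Local Open Scope ring_scope.

(** * Unique fixed points of p-groups *)

Section Fixpoints.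

Variables (aT : finGroupType) (X : finType) (to : {action aT &-> X}).
Variable Y : {set X}.

(** The subgroup [T] has a single fixed point in the orbit of [x] under [S], so
    the size of this orbit is 1 modulo [p]; it is also a power of [p]. *)
Lemma afix_unique_pgroup p (T S : {group aT}) x :
    prime p -> p.-group S -> T \subset S -> [acts S, on Y | to] ->
  'Fix_(Y | to)(T) = [set x] -> 'Fix_(Y | to)(S) = [set x].
Proof.
move=> p_pr pS sTS actsY fixT.
have /setIP[Yx xfixT] : x \in 'Fix_(Y | to)(T) by rewrite fixT set11.
have sOY : orbit to S x \subset Y by rewrite acts_sub_orbit.
have fixTO : 'Fix_(orbit to S x | to)(T) = [set x].
  apply/eqP; rewrite eqEsubset sub1set inE orbit_refl xfixT -{1}fixT.
  by rewrite setSI.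
have actsO : [acts T, on orbit to S x | to].
  by rewrite (subset_trans sTS) ?acts_orbit ?subsetT.
have := pgroup_fix_mod (pgroupS sTS pS) actsO; rewrite fixTO cards1 => card1.
have O1 : #|orbit to S x| = 1%N.
  have /p_natP[[|k] ok //] : p.-nat #|orbit to S x|.
    exact: pnat_dvd (dvdn_orbit to S x) pS.
  move: card1; rewrite ok expnS modnMr modn_small // prime_gt1 //.
have xfixS : x \in 'Fix_to(S) by apply/orbit1P; apply: card_orbit1.
by apply/eqP; rewrite eqEsubset sub1set inE Yx xfixS -fixT setIS ?afixS.
Qed.

Lemma afix_unique_conj (T : {set aT}) x g :
    g \in 'N(Y | to) ->
  'Fix_(Y | to)(T) = [set x] -> 'Fix_(Y | to)(T :^ g) = [set to x g].
Proof.
move=> NYg fixT; apply/setP=> y; rewrite in_setI in_set1.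
rewrite -[y in LHS](actKV to g) (astabs_act _ NYg).
have -> : (y == to x g) = (to y g^-1%g == x).
  by rewrite -[RHS](inj_eq (act_inj to g)) actKV.
rewrite -in_set1 -fixT in_setI actKV; congr (_ && _).
apply/afixP/afixP => fixy t.
  move=> Tt; rewrite -actM conjgCV invgK actM fixy //.
  by rewrite memJ_conjg.
case/imsetP=> u Tu ->.
by rewrite conjgE !actM fixy // actKV.
Qed.

Lemma afix_unique_Sylow p (G T S : {group aT}) x g :
    prime p -> p.-group S -> S \subset G -> g \in G -> T :^ g \subset S ->
    [acts G, on Y | to] ->
  'Fix_(Y | to)(T) = [set x] -> 'Fix_(Y | to)(S) = [set to x g].
Proof.
move=> p_pr pS sSG Gg sTgS actsG fixT.
apply: (@afix_unique_pgroup p (T :^ g)%G) => //; first exact: subset_trans actsG.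
by apply: afix_unique_conj fixT; apply: (subsetP actsG).
Qed.

End Fixpoints.

(** * Points, hyperplanes and collineations *)

Section ProjectiveGeometry.

Variables (F : finFieldType) (r : nat).
Local Notation V := 'rV[F]_r.+1.
Implicit Types (P Q : point F r) (W : hyperplane F r) (v : V).

Lemma mulmx_unit_neq0 (A : 'M[F]_r.+1) v :
  A \in unitmx -> v != 0 -> v *m A != 0.
Proof.
by move=> uA nzv; rewrite -[0](mul0mx _ A) (inj_eq (can_inj (mulmxK uA))).
Qed.

Lemma point_span P v : v != 0 -> v \in val P -> val P = <[v]>%VS.
Proof.
move=> nzv vP; apply/eqP.
by rewrite eq_sym eqEdim -memvE vP dim_vline nzv (eqP (valP P)).
Qed.

Lemma point_gen P : exists2 v, v != 0 & v \in val P.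
Proof.
exists (vpick (val P)); last exact: memv_pick.
by rewrite vpick0 -dimv_eq0 (eqP (valP P)).
Qed.

Lemma point_through v : v != 0 -> exists P, v \in val P.
Proof.
move=> nzv; have dimv : \dim <[v]> == 1%N by rewrite dim_vline nzv.
by exists (exist _ <[v]>%VS dimv); apply: memv_line.
Qed.

Lemma point_eq P Q v : v != 0 -> v \in val P -> v \in val Q -> P = Q.
Proof.
move=> nzv vP vQ; apply: val_inj.
by rewrite (point_span nzv vP) (point_span nzv vQ).
Qed.

Lemma incident_gen P W v : v != 0 -> v \in val P -> incident P W = (v \in val W).
Proof. by move=> nzv vP; rewrite /incident (point_span nzv vP) -memvE. Qed.

Lemma points_of_inj : injective (@points_of F r).
Proof.
move=> W W' eqW; apply: val_inj; apply/vspaceP=> v.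
have [->|nzv] := eqVneq v 0; first by rewrite !mem0v.
have [P vP] := point_through nzv.
by have /setP/(_ P) := eqW; rewrite !inE !(incident_gen _ nzv vP).
Qed.

Lemma hyperplane_of_covector (h : 'cV[F]_r.+1) :
  h != 0 -> exists W, forall v, (v \in val W) = (v *m h == 0).
Proof.
move=> nzh; pose f := linfun (mulmxr h : V -> 'M[F]_1).
have fE v : f v = v *m h by rewrite lfunE.
have dimf : \dim (limg f) = 1%N.
  apply/eqP; rewrite eqn_leq; apply/andP; split.
    by rewrite (leq_trans (dimvS (subvf _))) // dimvf.
  rewrite lt0n dimv_eq0 -subv0; apply: contra nzh => /subvP f0.
  apply/eqP/matrixP=> i j; rewrite ord1 mxE.
  have := f0 _ (memv_img f (memvf (delta_mx 0 i))).
  by rewrite fE memv0 -rowE => /eqP/rowP/(_ 0); rewrite !mxE.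
have dimW : \dim (lker f) == r.
  have := limg_ker_dim f fullv; rewrite capfv dimf dimvf addn1 /dim /= mul1n.
  by case=> ->.
by exists (exist _ (lker f) dimW) => v /=; rewrite memv_ker fE.
Qed.

(** The matrix [B] with a basis of [W] as its columns has rank less than its
    number of rows, so some nonzero row [k] satisfies [k *m B = 0]; then [k^T]
    vanishes on [W], and dimensions force equality. *)
Lemma covector_of_hyperplane W :
  exists2 h : 'cV[F]_r.+1, h != 0 & forall v, (v \in val W) = (v *m h == 0).
Proof.
have dimW := eqP (valP W); set U := val W in dimW *.
pose B : 'M[F]_(r.+1, \dim U) := \matrix_(i, j) (vbasis U)`_j 0 i.
have : kermx B != 0.
  rewrite kermx_eq0 /row_free neq_ltn (leq_ltn_trans (rank_leq_col B)) //.
  by rewrite dimW.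
case/rowV0Pn=> k /sub_kermxP kB nzk.
have nzh : k^T != 0 by rewrite -(inj_eq trmx_inj) trmxK trmx0.
have [W' W'E] := hyperplane_of_covector nzh.
suff sUW' : (U <= val W')%VS.
  have /eqP eqUW' : U == val W' by rewrite eqEdim sUW' dimW (eqP (valP W')) /=.
  by exists k^T => // v; rewrite -W'E -eqUW'.
apply/subvP=> v /coord_vbasis ->; apply: memv_suml => i _; apply: memvZ.
rewrite W'E; apply/eqP.
have /rowP/(_ i) := kB; rewrite !mxE => kBi.
apply/matrixP=> a b; rewrite !ord1 !mxE -[RHS]kBi.
by apply: eq_bigr => j _; rewrite !mxE mulrC.
Qed.

Lemma exists_axis : exists W, forall v, (v \in val W) = (v 0 0 == 0).
Proof.
have nz0 : (delta_mx 0 0 : 'cV[F]_r.+1) != 0.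
  by apply/eqP=> /colP/(_ 0)/eqP; rewrite !mxE !eqxx oner_eq0.
have [W WE] := hyperplane_of_covector nz0; exists W => v.
rewrite WE -colE; apply/eqP/eqP=> [/colP/(_ 0) | v0]; first by rewrite !mxE.
by apply/colP=> i; rewrite ord1 !mxE.
Qed.

(** If [h] is an equation of [W], then [A^-1 theta(h)] is an equation of its
    image under [v |-> theta(v) A]. *)
Lemma PGammaL_hyperplane (s : {perm point F r}) W :
  s \in PGammaL F r -> exists W', s @: points_of W = points_of W'.
Proof.
rewrite inE => /existsP[theta /existsP[A /and3P[theta_aut uA sA]]].
have [h nzh Wh] := covector_of_hyperplane W.
have [theta0 _] := field_aut1 theta_aut.
have eq0 m n (B : 'M[F]_(m, n)) : (map_mx theta B == 0) = (B == 0).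
  have {1}-> : 0 = map_mx theta 0 :> 'M_(m, n).
    by apply/matrixP=> i j; rewrite !mxE.
  apply/eqP/eqP=> [/matrixP eqB | -> //]; apply/matrixP=> i j.
  by have := eqB i j; rewrite !mxE => /perm_inj.
have nzh' : invmx A *m map_mx theta h != 0.
  by rewrite -[0](mulmx0 _ (invmx A)) (inj_eq (can_inj (mulKVmx uA))) eq0.
have [W' W'h] := hyperplane_of_covector nzh'.
exists W'; apply/setP=> P.
rewrite -[P](permKV s) (mem_imset _ _ perm_inj) !inE.
move: (s^-1%g P) => Q; have [v nzv vQ] := point_gen Q.
have wsQ : map_mx theta v *m A \in val (s Q).
  exact: implyP (forallP (forallP sA Q) v) vQ.
have nzw : map_mx theta v *m A != 0.
  by rewrite mulmx_unit_neq0 // eq0.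
rewrite (incident_gen _ nzv vQ) (incident_gen _ nzw wsQ) Wh W'h.
by rewrite !mulmxA mulmxK // -map_mx_field_autM // eq0.
Qed.

Lemma map_mx_perm1 m n (A : 'M[F]_(m, n)) : map_mx (1%g : {perm F}) A = A.
Proof. by apply/matrixP=> i j; rewrite mxE perm1. Qed.

Lemma induced_by1P (A : 'M[F]_r.+1) (s : {perm point F r}) :
  induced_by 1%g A s -> forall P v, v \in val P -> v *m A \in val (s P).
Proof.
move=> sA P v vP; have := implyP (forallP (forallP sA P) v) vP.
by rewrite map_mx_perm1.
Qed.

Lemma induced_by1I (A : 'M[F]_r.+1) (s : {perm point F r}) :
  (forall P v, v \in val P -> v *m A \in val (s P)) -> induced_by 1%g A s.
Proof.
move=> sA; apply/forallP=> P; apply/forallP=> v; apply/implyP=> /sA.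
by rewrite map_mx_perm1.
Qed.

Lemma linear_collineation (A : 'M[F]_r.+1) :
  A \in unitmx -> exists s : {perm point F r}, induced_by 1%g A s.
Proof.
move=> uA; pose f := linfun (mulmxr A : V -> V).
have fE v : f v = v *m A by rewrite lfunE.
have kerf : lker f == 0%VS.
  apply/eqP/vspaceP=> v; rewrite memv_ker memv0 fE.
  by rewrite -(inj_eq (can_inj (mulmxK uA)) v) mul0mx.
have dimf P : \dim (f @: val P) == 1%N.
  by rewrite limg_dim_eq ?(valP P) // (eqP kerf) capv0.
pose g P : point F r := exist _ (f @: val P)%VS (dimf P).
have g_inj : injective g.
  move=> P Q /(congr1 (fun R => f^-1 @: val R)%VS) /=.
  by rewrite -!limg_comp lker0_compVf // !lim1g => /val_inj.
by exists (perm g_inj); apply: induced_by1I => P v vP; rewrite permE -fE memv_img.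
Qed.

Lemma induced_by1 : induced_by 1%g 1%:M (1%g : {perm point F r}).
Proof. by apply: induced_by1I => P v; rewrite mulmx1 perm1. Qed.

Lemma induced_byM (A B : 'M[F]_r.+1) (s t : {perm point F r}) :
  induced_by 1%g A s -> induced_by 1%g B t -> induced_by 1%g (A *m B) (s * t)%g.
Proof.
move=> sA tB; apply: induced_by1I => P v vP.
by rewrite permM mulmxA (induced_by1P tB) // (induced_by1P sA).
Qed.

Lemma induced_by1_eq (s : {perm point F r}) : induced_by 1%g 1%:M s -> s = 1%g.
Proof.
move=> s1; apply/permP=> P; have [v nzv vP] := point_gen P.
have := induced_by1P s1 vP; rewrite mulmx1 perm1 => vsP.
exact: point_eq nzv vsP vP.
Qed.

End ProjectiveGeometry.

(** * A 2-group of automorphisms of the variety *)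

Section Heisenberg.

Variables (F : finFieldType) (e r : nat) (eps : F).
Local Notation q := (2 ^ e)%N.
Local Notation sigma := (2 ^ (e.+1)./2)%N.
Hypotheses (r_gt0 : (0 < r)%N) (pchar2 : 2 \in [pchar F]).
Hypothesis eps_q : eps ^+ q = eps + 1.

Implicit Types (P : point F r) (v : 'rV[F]_r.+1) (c : F).

Local Notation mid i := (0 < (i : 'I_r.+1) < r)%N.

Let two0 : 2%:R = 0 :> F. Proof. exact: pcharf0 pchar2. Qed.

Lemma frobenius k (x y : F) : (x + y) ^+ (2 ^ k) = x ^+ (2 ^ k) + y ^+ (2 ^ k).
Proof. by apply: exprDn_pchar; rewrite pnatX pnatE // pchar2. Qed.

Lemma frobenius_sum k I (P : pred I) (s : seq I) (f : I -> F) :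
  (\sum_(i <- s | P i) f i) ^+ (2 ^ k) = \sum_(i <- s | P i) f i ^+ (2 ^ k).
Proof.
by apply: (big_morph _ (frobenius k)); rewrite expr0n expn_eq0.
Qed.

(** The bracket [x + (x^q + x) eps] is the component [x0] of [x], which does not
    see the translation, while [x^q + x = x1] becomes [x1 + b]; the linear part
    [b x0] of the change is the trace of [b eps^q x]. *)
Lemma Gamma_shift (x b : F) : b ^+ q = b ->
  Gamma e eps (x + b * eps)
  = Gamma e eps x
    + ((b * eps ^+ q * x) ^+ q + b * eps ^+ q * x) + b ^+ sigma.
Proof.
move=> bq.
have conj_shift : (x + b * eps) ^+ q = x ^+ q + b * (eps + 1).
  by rewrite frobenius exprMn bq eps_q.
have -> : (b * eps ^+ q * x) ^+ q = b * (eps + 1 + 1) * x ^+ q.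
  by rewrite eps_q !exprMn bq frobenius eps_q expr1n.
rewrite /Gamma ![(2 * q)%N]mulnC !(exprM _ q 2) !(addn1 q) !exprSr.
rewrite conj_shift eps_q.
move: (x ^+ q) => y.
have -> : y + b * (eps + 1) + (x + b * eps) = y + x + b + 2%:R * (b * eps).
  by ring.
have -> : x + b * eps + (y + x + b + 2%:R * (b * eps)) * eps
          = x + (y + x) * eps + 2%:R * (b * eps + b * eps ^+ 2) by ring.
(* What remains is an identity modulo 2: over the integers the two sides differ
   by twice the expression below. *)
rewrite two0 !mul0r !addr0 (frobenius _ (y + x)) -[LHS]addr0.
rewrite -(mul0r (y * b - y * b * (eps ^+ 2 + eps) - x * b * eps ^+ 2 - x * b * eps
                 - b ^+ 2 * (eps ^+ 3 + eps ^+ 2 *+ 2 + eps))) -two0.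
ring.
Qed.

(** In affine coordinates, the map [x_i |-> x_i + b_i eps] for [0 < i < r] and
    [x_r |-> x_r + sum_i b_i eps^q x_i + c], acting on row vectors. *)
Definition heisenberg (b : 'I_r.+1 -> F) (c : F) : 'M[F]_r.+1 :=
  1%:M + (delta_mx 0 0 : 'cV_r.+1) *m (\row_j if mid j then b j * eps else 0)
  + (\col_i (if mid i then b i * eps ^+ q else 0) + c *: delta_mx 0 0)
      *m delta_mx 0 ord_max.

Lemma heisenbergE b c v j :
  (v *m heisenberg b c) 0 j
  = v 0 j + (if mid j then v 0 0 * (b j * eps) else 0)
    + (if j == ord_max then \sum_(i | mid i) b i * eps ^+ q * v 0 i + c * v 0 0
       else 0).
Proof.
rewrite /heisenberg !mulmxDr mulmx1 mulmxA -colE mulmxA mulmxDr -scalemxAr -colE.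
rewrite !mxE !big_ord1 !mxE eqxx andTb.
congr (_ + _ + _); first by case: ifP; rewrite ?mulr0.
rewrite eq_sym; case: eqP; rewrite ?mulr0 ?mulr1 // => _; congr (_ + _).
rewrite [RHS]big_mkcond; apply: eq_bigr => i _; rewrite mxE.
by case: ifP; rewrite ?mulr0 // mulrC.
Qed.

Lemma heisenbergE0 b c v : (v *m heisenberg b c) 0 0 = v 0 0.
Proof.
have nmax : 0 != ord_max :> 'I_r.+1 by rewrite neq_ltn r_gt0.
by rewrite heisenbergE (negPf nmax) !addr0.
Qed.

Lemma heisenbergE_mid b c v j : mid j ->
  (v *m heisenberg b c) 0 j = v 0 j + v 0 0 * (b j * eps).
Proof.
move=> mj; have nmax : j != ord_max by rewrite neq_ltn; case/andP: mj => _ ->.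
by rewrite heisenbergE mj (negPf nmax) addr0.
Qed.

Lemma heisenbergE_max b c v :
  (v *m heisenberg b c) 0 ord_max
  = v 0 ord_max + (\sum_(i | mid i) b i * eps ^+ q * v 0 i + c * v 0 0).
Proof. by rewrite heisenbergE /= ltnn andbF eqxx addr0. Qed.

Lemma heisenberg_comp b c b' c' :
  heisenberg b c *m heisenberg b' c'
  = heisenberg (fun i => b i + b' i)
      (c + c' + eps * eps ^+ q * \sum_(i | mid i) b i * b' i).
Proof.
apply/row_matrixP=> k; rewrite !rowE mulmxA; move: (delta_mx 0 k) => v.
apply/rowP=> j.
rewrite [LHS]heisenbergE [RHS]heisenbergE heisenbergE0 heisenbergE.
case: (eqVneq j ord_max) => [-> | _]; last first.
  by case: ifP => _; rewrite ?addr0 // -addrA mulrDl mulrDr.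
rewrite ltnn andbF !addr0 -addrA; congr (_ + _).
under [\sum_(i | _) b' i * _ * _]eq_bigr => i mi
  do rewrite heisenbergE_mid // mulrDr.
rewrite big_split /= [eps * _ * _]mulr_sumr.
under [in RHS]eq_bigr do rewrite mulrDl mulrDl.
rewrite big_split /= !mulrDl mulr_suml.
set s1 := \sum_(i | mid i) _; set s2 := \sum_(i | mid i) _.
set s3 := \sum_(i | mid i) _.
suff -> : s3 = \sum_(i | mid i) eps * eps ^+ q * (b i * b' i) * v 0 0 by ring.
by apply: eq_bigr => i _; ring.
Qed.

Lemma heisenberg0 : heisenberg (fun=> 0) 0 = 1%:M.
Proof.
apply/row_matrixP=> k; rewrite !rowE mulmx1; apply/rowP=> j.
rewrite heisenbergE big1 => [|i _]; last by rewrite !mul0r.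
by rewrite !mul0r mulr0 addr0 !if_same !addr0.
Qed.

Lemma eq_heisenberg b b' c : b =1 b' -> heisenberg b c = heisenberg b' c.
Proof.
move=> eqb; apply/row_matrixP=> k; rewrite !rowE; apply/rowP=> j.
by rewrite !heisenbergE eqb; under eq_bigr do rewrite eqb.
Qed.

Lemma heisenberg_unit b c : heisenberg b c \in unitmx.
Proof.
pose d := eps * eps ^+ q * \sum_(i | mid i) b i * b i.
suff /mulmx1_unit[] : heisenberg b c *m heisenberg b (c + d) = 1%:M by [].
rewrite heisenberg_comp -/d -heisenberg0 [c + _ + d]addrAC (addrr_pchar2 pchar2).
by apply: eq_heisenberg => i; rewrite addrr_pchar2.
Qed.

(** Squaring doubles [b], so only an elation is left, and elations are
    involutions in characteristic 2. *)
Lemma heisenberg_sqr b c :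
  heisenberg b c *m heisenberg b c
  = heisenberg (fun=> 0) (eps * eps ^+ q * \sum_(i | mid i) b i * b i).
Proof.
rewrite heisenberg_comp (addrr_pchar2 pchar2) add0r.
by apply: eq_heisenberg => i; rewrite (addrr_pchar2 pchar2).
Qed.

Lemma heisenberg_exp4 b c :
  let A := heisenberg b c in A *m A *m (A *m A) = 1%:M.
Proof.
rewrite /= !heisenberg_sqr big1 => [|i _]; first by rewrite mulr0 heisenberg0.
by rewrite mulr0.
Qed.

(** The first condition makes [Gamma_shift] applicable; the second makes the trace
    of the constant [c] compensate the terms [b_i^sigma] that it leaves. *)
Definition heis_params (b : 'I_r.+1 -> F) (c : F) : bool :=
  [forall i, b i ^+ q == b i]
  && (c ^+ q + c == \sum_(i : 'I_r.+1 | mid i) b i ^+ sigma).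

Lemma BT_affine_heisenberg b c v : heis_params b c ->
  BT_affine e eps v -> BT_affine e eps (v *m heisenberg b c).
Proof.
case/andP=> /forallP bq /eqP cq; rewrite /BT_affine => /andP[v0 /eqP eqv].
rewrite heisenbergE0 v0 /=.
have coord_mid i : mid i ->
    affine_coord (v *m heisenberg b c) i = affine_coord v i + b i * eps.
  move=> mi; rewrite /affine_coord heisenbergE0 heisenbergE_mid // mulrDl.
  by rewrite [v 0 0 * _]mulrC mulfK.
have coord_max : affine_coord (v *m heisenberg b c) ord_max
    = affine_coord v ord_max
      + (\sum_(i | mid i) b i * eps ^+ q * affine_coord v i + c).
  rewrite /affine_coord heisenbergE0 heisenbergE_max !mulrDl mulfK // mulr_suml.
  by under eq_bigr do rewrite -mulrA.
rewrite coord_max !frobenius frobenius_sum.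
under [X in _ == X]eq_bigr => i mi.
  by rewrite coord_mid // Gamma_shift ?(eqP (bq i)) //; over.
rewrite 2!big_split /= -eqv -cq big_split /=; apply/eqP; ring.
Qed.

Lemma BT_infinity_heisenberg b c v :
  BT_infinity e v -> BT_infinity e (v *m heisenberg b c).
Proof.
case/andP=> v0 /eqP eqv.
rewrite /BT_infinity heisenbergE0 v0 /= -[X in _ == X]eqv.
apply/eqP/eq_bigr => i mi.
by rewrite heisenbergE_mid // (eqP v0) mul0r addr0.
Qed.

Definition heis_group_set : {set {perm point F r}} :=
  [set s | [exists b : {ffun 'I_r.+1 -> F}, exists c,
     heis_params b c && induced_by 1%g (heisenberg b c) s]].

Lemma heis_group_setP : group_set heis_group_set.
Proof.
apply/group_setP; split=> [|s t].
  rewrite inE; apply/existsP; exists 0; apply/existsP; exists 0.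
  rewrite (@eq_heisenberg _ (fun=> 0)) ?heisenberg0; last first.
    by move=> i; rewrite ffunE.
  rewrite induced_by1 andbT /heis_params expr0n expn_eq0 /= addr0 eq_sym big1.
    by rewrite eqxx andbT; apply/forallP=> i; rewrite ffunE expr0n expn_eq0.
  by move=> i _; rewrite ffunE expr0n expn_eq0.
rewrite !inE => /existsP[b /existsP[c /andP[/andP[/forallP bq /eqP cq] sA]]].
case/existsP=> b' /existsP[c' /andP[/andP[/forallP bq' /eqP cq'] tA]].
apply/existsP; exists (b + b'); apply/existsP.
exists (c + c' + eps * eps ^+ q * \sum_(i | mid i) b i * b' i).
apply/andP; split; last first.
  rewrite (@eq_heisenberg _ (fun i => b i + b' i)); last first.
    by move=> i; rewrite ffunE.
  by rewrite -heisenberg_comp induced_byM.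
apply/andP; split.
  by apply/forallP=> i; rewrite ffunE frobenius (eqP (bq i)) (eqP (bq' i)).
under [X in _ == X]eq_bigr do rewrite ffunE frobenius.
rewrite big_split /= -cq -cq'.
set d := \sum_(i | mid i) b i * b' i.
have dq : d ^+ q = d.
  rewrite frobenius_sum; apply: eq_bigr => i _.
  by rewrite exprMn (eqP (bq i)) (eqP (bq' i)).
rewrite !frobenius eps_q !exprMn dq frobenius eps_q expr1n.
rewrite -subr_eq0; apply/eqP.
(* The product [eps * eps^q] has zero trace. *)
rewrite -[RHS](mul0r ((eps + 1) ^+ 2 * d)) -two0; ring.
Qed.

Canonical heis_group := Group heis_group_setP.

Lemma heis_group_2group : 2.-group heis_group.
Proof.
rewrite -pnat_exponent (@pnat_dvd _ 4) //; apply/exponentP=> s.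
rewrite inE => /existsP[b /existsP[c /andP[_ sA]]].
have := induced_byM (induced_byM sA sA) (induced_byM sA sA).
by rewrite heisenberg_exp4 => /induced_by1_eq; rewrite !expgS expg0 mulg1 !mulgA.
Qed.

Lemma heis_group_Aut : heis_group \subset Aut_BT e r eps.
Proof.
apply/subsetP=> s; rewrite inE => /existsP[b /existsP[c /andP[bc sA]]].
rewrite inE [_ \in PGammaL _ _]inE; apply/andP; split.
  apply/existsP; exists 1%g; apply/existsP; exists (heisenberg b c).
  rewrite heisenberg_unit sA andbT andbT.
  by apply/forallP=> x; apply/forallP=> y; rewrite !perm1 !eqxx.
rewrite !inE; apply/subsetP=> P; rewrite !inE.
case/existsP=> v /andP[/andP[nzv vP] BTv].
apply/existsP; exists (v *m heisenberg b c); rewrite /homogeneous_coords.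
rewrite (induced_by1P sA) // andbT; apply/andP; split.
  by rewrite mulmx_unit_neq0 ?heisenberg_unit.
by case/orP: BTv => [/BT_affine_heisenberg-> // | /BT_infinity_heisenberg->];
  rewrite ?orbT.
Qed.

(** The next two lemmas isolate the only elements needed to determine the fixed
    points and hyperplanes: the elation with [b = 0] and [c = 1], and for each
    [i] the element where [b_i = 1] is the only nonzero entry and [c = eps],
    whose trace is 1. *)
Lemma heis_translation :
  exists2 s, s \in heis_group &
    forall P v, v \in val P -> v + v 0 0 *: delta_mx 0 ord_max \in val (s P).
Proof.
have [s sA] := linear_collineation (heisenberg_unit (fun=> 0) 1).
exists s => [|P v /(induced_by1P sA)].
  rewrite inE; apply/existsP; exists [ffun=> 0]; apply/existsP; exists 1.
  rewrite (@eq_heisenberg _ (fun=> 0)) ?sA ?andbT; last first.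
    by move=> i; rewrite ffunE.
  rewrite /heis_params expr1n addrr_pchar2 // eq_sym big1.
    by rewrite eqxx andbT; apply/forallP=> i; rewrite ffunE expr0n expn_eq0.
  by move=> i _; rewrite ffunE expr0n expn_eq0.
suff -> : v *m heisenberg (fun=> 0) 1 = v + v 0 0 *: delta_mx 0 ord_max by [].
apply/rowP=> j; rewrite heisenbergE !mxE eqxx /=.
rewrite mul0r mulr0 if_same addr0; congr (_ + _).
rewrite big1 => [|i _]; last by rewrite !mul0r.
by rewrite add0r mul1r; case: eqP; rewrite ?mulr1 ?mulr0.
Qed.

Lemma heis_shear (i : 'I_r.+1) : mid i ->
  exists2 s, s \in heis_group &
    forall P v, v \in val P ->
      v + (v 0 0 * eps) *: delta_mx 0 i
        + ((eps + 1) * v 0 i + eps * v 0 0) *: delta_mx 0 ord_max \in val (s P).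
Proof.
move=> mi; pose b j : F := (j == i)%:R.
have [s sA] := linear_collineation (heisenberg_unit b eps).
have b_exp j k : b j ^+ (2 ^ k) = b j.
  by rewrite /b; case: eqP; rewrite ?expr1n // expr0n expn_eq0.
have sum_b f : \sum_(j | mid j) b j * f j = f i.
  rewrite (bigD1 i) //= /b eqxx mul1r big1 ?addr0 // => j /andP[_ /negPf->].
  by rewrite mul0r.
exists s => [|P v /(induced_by1P sA)].
  rewrite inE; apply/existsP; exists (finfun b); apply/existsP; exists eps.
  rewrite (@eq_heisenberg _ b) ?sA ?andbT; last by move=> j; rewrite ffunE.
  apply/andP; split; first by apply/forallP=> j; rewrite ffunE b_exp.
  under eq_bigr => j _ do rewrite ffunE b_exp -[b j]mulr1.
  by rewrite sum_b eps_q addrAC addrr_pchar2 // add0r.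
suff -> : v *m heisenberg b eps = v + (v 0 0 * eps) *: delta_mx 0 i
        + ((eps + 1) * v 0 i + eps * v 0 0) *: delta_mx 0 ord_max by [].
apply/rowP=> j; rewrite heisenbergE !mxE eqxx /=.
congr (_ + _ + _).
  case: ifP => [_ | nmj].
    by rewrite /b; case: eqP => _; rewrite ?mul1r ?mulr1 // mul0r !mulr0.
  by case: eqP nmj => [-> | _ _]; rewrite ?mi // mulr0.
under eq_bigr do rewrite -mulrA.
by rewrite sum_b eps_q; case: eqP => _; rewrite ?mulr1 ?mulr0.
Qed.

End Heisenberg.

(** * The flag fixed by this 2-group *)

Section FixedFlag.

Variables (F : finFieldType) (e r : nat) (eps : F).
Hypotheses (r_gt0 : (0 < r)%N) (pchar2 : 2 \in [pchar F]).
Hypothesis eps_q : eps ^+ (2 ^ e) = eps + 1.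

Local Notation mid i := (0 < (i : 'I_r.+1) < r)%N.
Local Notation H := (heis_group r_gt0 pchar2 eps_q).
Local Notation center := (delta_mx 0 ord_max : 'rV[F]_r.+1).
Implicit Types (P : point F r) (W : hyperplane F r) (v : 'rV[F]_r.+1).

Lemma eps_neq0 : eps != 0.
Proof.
apply/eqP=> eps0; have := eps_q.
by move/eqP; rewrite eps0 expr0n expn_eq0 add0r eq_sym oner_eq0.
Qed.

Lemma eps1_neq0 : eps + 1 != 0.
Proof. by rewrite -eps_q expf_neq0 ?eps_neq0. Qed.

Lemma center_neq0 : center != 0.
Proof.
apply/eqP=> /rowP/(_ ord_max)/eqP.
by rewrite !mxE !eqxx oner_eq0.
Qed.

Lemma center0 : center 0 0 = 0.
Proof. by rewrite mxE eqxx [_ == _]ltn_eqF. Qed.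

Lemma coord_cases (j : 'I_r.+1) : [\/ j = 0, mid j | j = ord_max].
Proof.
have [j0|j_gt0] := posnP j; first by apply: Or31; apply: val_inj.
have := ltn_ord j; rewrite ltnS leq_eqVlt => /orP[/eqP jr|jr].
  by apply: Or33; apply: val_inj.
by apply: Or32.
Qed.

Lemma heis_center P s : s \in H -> center \in val P -> s P = P.
Proof.
rewrite inE => /existsP[b /existsP[c /andP[_ sA]]] cP.
have := induced_by1P sA cP; suff -> : center *m heisenberg e eps b c = center.
  by move=> csP; apply: point_eq center_neq0 csP cP.
have nmax : 0 != ord_max :> 'I_r.+1 by rewrite neq_ltn r_gt0.
apply/rowP=> j; rewrite heisenbergE !mxE (negPf nmax) andbF mul0r if_same addr0.
rewrite big1 => [|i /andP[_ ir]].
  by rewrite mulr0 addr0 if_same addr0.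
by rewrite mxE [i == _]ltn_eqF // andbF mulr0.
Qed.

(** If [v] spans a fixed point that is not the center, then every element moving
    [v] by a multiple of the center must fix [v]: the elation gives [v_0 = 0],
    and then the shears give [v_i = 0] for [0 < i < r]. *)
Lemma heis_fix_point P : (forall s, s \in H -> s P = P) -> center \in val P.
Proof.
move=> fixP; have [v nzv vP] := point_gen P; apply/negPn/negP=> ncP.
have scale_center a : a *: center \in val P -> a = 0.
  move=> acP; apply/eqP; apply: contraNT ncP => nza.
  by rewrite -(scale1r center) -(mulVf nza) -scalerA memvZ.
have v0 : v 0 0 = 0.
  apply: scale_center; have [s Hs sP] := heis_translation r_gt0 pchar2 eps_q.
  by have := sP P v vP; rewrite fixP // rpredDl.
have v_mid i : mid i -> v 0 i = 0.
  move=> mi; have [s Hs sP] := heis_shear r_gt0 pchar2 eps_q mi.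
  have := sP P v vP; rewrite fixP // v0 mul0r scale0r addr0 mulr0 addr0.
  rewrite rpredDl //.
  by move/scale_center/eqP; rewrite mulf_eq0 (negPf eps1_neq0) => /eqP.
have vE : v = v 0 ord_max *: center.
  apply/rowP=> j; rewrite !mxE /=; have [->|mj|->] := coord_cases j.
  - by rewrite v0 [_ == _]ltn_eqF // mulr0.
  - by rewrite v_mid // [_ == _]ltn_eqF ?mulr0 //; case/andP: mj.
  by rewrite eqxx mulr1.
by move: nzv; rewrite vE (scale_center (v 0 ord_max)) ?scale0r ?eqxx // -vE.
Qed.

Lemma heis_axis W s : (forall v, (v \in val W) = (v 0 0 == 0)) ->
  s \in H -> s @: points_of W = points_of W.
Proof.
move=> WE; rewrite inE => /existsP[b /existsP[c /andP[_ sA]]].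
apply/eqP; rewrite eqEcard card_imset ?leqnn ?andbT; last exact: perm_inj.
apply/subsetP=> _ /imsetP[P + ->]; rewrite !inE.
have [v nzv vP] := point_gen P; rewrite (incident_gen _ nzv vP) WE => v0.
have nzw : v *m heisenberg e eps b c != 0.
  by rewrite mulmx_unit_neq0 // (heisenberg_unit e eps r_gt0 pchar2).
by rewrite (incident_gen _ nzw (induced_by1P sA vP)) WE heisenbergE0.
Qed.

(** A fixed hyperplane containing a vector [v] with [v_0 != 0] contains the
    differences of [v] and its images; these produce all the unit vectors
    except the one of index 0, and together with [v] they span everything. *)
Lemma heis_fix_hyperplane W :
  (forall s, s \in H -> s @: points_of W = points_of W) ->
  forall v, (v \in val W) = (v 0 0 == 0).
Proof.
move=> fixW.
have image_in s P u v : s \in H -> v \in val P -> v != 0 -> v \in val W ->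
    u \in val (s P) -> u \in val W.
  move=> Hs vP nzv vW; apply/subvP; rewrite -/(incident _ _).
  have : s P \in s @: points_of W.
    by rewrite imset_f // inE (incident_gen _ nzv vP).
  by rewrite fixW // inE.
have W0 v : v \in val W -> v 0 0 = 0.
  move=> vW; apply/eqP; apply: contraT => nzv0.
  have nzv : v != 0 by apply: contraNneq nzv0 => ->; rewrite mxE.
  have [P vP] := point_through nzv.
  have cW : center \in val W.
    have [s Hs sP] := heis_translation r_gt0 pchar2 eps_q.
    have := image_in _ _ _ _ Hs vP nzv vW (sP P v vP).
    rewrite rpredDl // => /(memvZ (v 0 0)^-1).
    by rewrite scalerA mulVf // scale1r.
  have midW i : mid i -> delta_mx 0 i \in val W.
    move=> mi; have [s Hs sP] := heis_shear r_gt0 pchar2 eps_q mi.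
    have := image_in _ _ _ _ Hs vP nzv vW (sP P v vP).
    rewrite rpredDr ?memvZ // rpredDl //; set a := _ * eps.
    have nza : a != 0 by rewrite mulf_neq0 ?eps_neq0.
    by move/(memvZ a^-1); rewrite scalerA mulVf // scale1r.
  suff : (fullv <= val W)%VS.
    by move/dimvS; rewrite dimvf (eqP (valP W)) /dim /= mul1n ltnn.
  apply/subvP=> u _.
  have -> : u = (u 0 0 / v 0 0) *: v + (u - (u 0 0 / v 0 0) *: v).
    by rewrite addrC subrK.
  rewrite memvD ?memvZ //; set w := u - _.
  have w0 : w 0 0 = 0 by rewrite !mxE divfK // subrr.
  rewrite [w]row_sum_delta; apply: memv_suml => j _.
  have [->|mj|->] := coord_cases j; first by rewrite w0 scale0r mem0v.
    by rewrite memvZ ?midW.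
  by rewrite memvZ.
have [W' W'E0] := exists_axis F r.
move=> v; rewrite -W'E0; suff /eqP-> : val W == val W' by [].
rewrite eqEdim (eqP (valP W)) (eqP (valP W')) leqnn andbT.
by apply/subvP=> u /W0 u0; rewrite W'E0 u0.
Qed.

End FixedFlag.

(** * The theorem *)

(** Both [eps] and [eps^q] are roots of [X^2 + X + delta], whose roots are [eps]
    and [eps + 1]. *)
Lemma eps_conj (F : finFieldType) e (eps delta : F) :
    2 \in [pchar F] -> eps \notin subfield_q F e ->
    delta \in subfield_q F e -> eps ^+ 2 + eps + delta = 0 ->
  eps ^+ (2 ^ e) = eps + 1.
Proof.
rewrite !inE => pchar2 epsF /eqP deltaF eq_eps.
have two0 : 2%:R = 0 :> F by apply: pcharf0 pchar2.
have eq_epsq : (eps ^+ (2 ^ e)) ^+ 2 + eps ^+ (2 ^ e) + delta = 0.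
  rewrite -{1}deltaF -exprM mulnC exprM -!(frobenius pchar2) eq_eps.
  by rewrite expr0n expn_eq0.
move: (eps ^+ _) epsF eq_epsq => y neq eqy.
have : (y - eps) * (y - (eps + 1)) = 0.
  rewrite -[RHS](mul0r (- y * eps - y - delta)) -two0.
  rewrite -[RHS]add0r -{1}eqy -[RHS]add0r -{1}eq_eps.
  ring.
by move/eqP; rewrite mulf_eq0 !subr_eq0 (negPf neq) => /eqP.
Qed.

Theorem lemma2p1 (e r : nat) (F : finFieldType) (eps delta : F)
  (he3 : (3 <= e)%N) (he_odd : odd e) (hr : (2 <= r)%N)
  (hF : #|F| = ((2 ^ e) ^ 2)%N)
  (heps : eps \notin subfield_q F e)
  (heq : eps ^+ 2 + eps + delta = 0)
  (hdelta : delta \in subfield_q F e) (hdelta1 : delta != 1)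
  (htr : abs_trace e delta = 1)
  (S : {group {perm point F r}}) (hS : 2.-Sylow(Aut_BT e r eps) S) :
  exists! PW : point F r * hyperplane F r, fixes_flag S PW.
Proof.
have r_gt0 : (0 < r)%N by apply: ltnW.
have pchar2 : 2 \in [pchar F].
  by apply: (card_finPcharP (n := e * 2)) => //; rewrite expnM.
have eps_q : eps ^+ (2 ^ e) = eps + 1 by apply: eps_conj heq.
pose H := heis_group r_gt0 pchar2 eps_q.
have [g Gg sHgS] := Sylow_Jsub hS (heis_group_Aut r_gt0 pchar2 eps_q)
  (heis_group_2group r_gt0 pchar2 eps_q).
have sSG : S \subset Aut_BT e r eps := pHall_sub hS.
have sGL : Aut_BT e r eps \subset PGammaL F r := subsetIl _ _.
have pS : 2.-group S := pHall_pgroup hS.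
have [P0 P0E] := point_through (center_neq0 F r).
have [W0 W0E] := exists_axis F r.
have fixP0 : 'Fix_(setT | 'P)(H) = [set P0].
  apply/setP=> P; rewrite in_setI in_setT in_set1 /=.
  apply/afixP/eqP=> [fixP | -> s Hs]; last exact: heis_center Hs P0E.
  by apply: point_eq (center_neq0 F r) _ P0E; apply: heis_fix_point fixP.
pose hyps := [set points_of W | W : hyperplane F r].
have fixW0 : 'Fix_(hyps | 'P^*)(H) = [set points_of W0].
  apply/setP=> A; rewrite in_setI in_set1.
  apply/andP/eqP=> [[/imsetP[W _ ->] /afixP fixW] | ->]; last first.
    by split; [apply: imset_f | apply/afixP=> s; apply: heis_axis].
  congr points_of; apply/val_inj/vspaceP=> v.
  by rewrite W0E; apply: heis_fix_hyperplane fixW v.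
have actsT : [acts Aut_BT e r eps, on setT | 'P].
  by apply/subsetP=> s _; rewrite !inE; apply/subsetP=> P; rewrite !inE.
have actsW : [acts Aut_BT e r eps, on hyps | 'P^*].
  apply/subsetP=> s Gs; rewrite !inE; apply/subsetP=> _ /imsetP[W _ ->].
  have [W' sW] := PGammaL_hyperplane W (subsetP sGL s Gs).
  by rewrite inE [_ s]sW imset_f.
have fixPS := afix_unique_Sylow (isT : prime 2) pS sSG Gg sHgS actsT fixP0.
have fixWS := afix_unique_Sylow (isT : prime 2) pS sSG Gg sHgS actsW fixW0.
have [W1 gW0] := PGammaL_hyperplane W0 (subsetP sGL g Gg).
rewrite /= setactE [[set _ | _ in _]]gW0 in fixWS.
have flagE P W :
    [/\ incident P W, S \subset 'C[P | 'P] & S \subset 'N(points_of W | 'P)]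
    <-> [/\ incident P W, P = g P0 & W = W1].
  have PE : (S \subset 'C[P | 'P]) = (P == g P0).
    transitivity (P \in 'Fix_(setT | 'P)(S)); last by rewrite fixPS in_set1.
    by rewrite in_setI in_setT; apply/subsetP/afixP => fixP s /fixP/astab1P.
  have WE : (S \subset 'N(points_of W | 'P)) = (W == W1).
    transitivity (points_of W \in 'Fix_(hyps | 'P^*)(S)); last first.
      by rewrite fixWS in_set1; apply/eqP/eqP=> [/points_of_inj|->].
    rewrite in_setI imset_f // -astab1_set.
    by apply/subsetP/afixP => fixW s /fixW/astab1P.
  split=> [[PW cP nW] | [PW /eqP eP /eqP eW]].
    by split=> //; apply/eqP; [rewrite -PE | rewrite -WE].
  by split; [| rewrite PE | rewrite WE].
exists (g P0, W1); split=> [|[P W] fixPW]; last first.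
  by have [_ -> ->] := (flagE P W).1 fixPW.
apply/flagE; split=> //.
have : g P0 \in points_of W1.
  rewrite -gW0 imset_f // inE (incident_gen _ (center_neq0 F r)) //.
  by rewrite W0E center0.
by rewrite inE.
Qed.
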